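(* Let $\mathcal{B}$ be the (infinite) set of all full binary trees, and let $$K(x,q) := \sum_{T\in\mathcal{B}} x^{V(T)} q^{JD(T)},$$ a formal power series in $x$ whose coefficients are polynomials in $q$. Then $$ K(x,q) = \frac{2 q}{\sqrt{1-4 q x}-1+2 q}, $$ where the square root denotes the formal power series square root with constant term $1$, and the identity holds in the ring $\mathbb{Q}(q)[[x]]$.
   Context: A full binary tree is an unlabeled ordered tree defined recursively: it is either the single-vertex tree, denoted $\cdot$, or a pair $T=[T_L,T_R]$ where $T_L$ (left subtree) and $T_R$ (right subtree) are full binary trees. The number of internal vertices $V(T)$ is defined by $V(\cdot)=0$, $V([T_L,T_R])=V(T_L)+V(T_R)+1$. The depth of the rightmost leaf $D(T)$ is defined by $D(\cdot)=0$, $D([T_L,T_R])=1+D(T_R)$. The sum of jump distances $JD(T)$ is defined by $JD(\cdot)=0$, $JD([T_L,T_R])=JD(T_L)+JD(T_R)+D(T_L)$. *)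

(* Defs.v *)
From HB Require Import structures.
From mathcomp Require Import all_boot all_order all_algebra.
From mathcomp Require Import boolp classical_sets functions cardinality fsbigop.

Set Implicit Arguments.
Unset Strict Implicit.
Unset Printing Implicit Defensive.

Import GRing.Theory.

Local Open Scope ring_scope.

Record fps (R : Type) := FPS { fps_coef :> nat -> R }.

Notation "{ 'fps' R }" := (fps R) (format "{ 'fps'  R }") : type_scope.

HB.instance Definition _ (R : Type) := gen_eqMixin {fps R}.
HB.instance Definition _ (R : Type) := gen_choiceMixin {fps R}.

Lemma fpsP (R : Type) (f g : {fps R}) : f =1 g <-> f = g.
Proof.
split=> [|->//]; case: f g => [f] [g] /= fg.
by congr FPS; apply: funext.
Qed.

Definition fps_zero (R : zmodType) : {fps R} := FPS (fun=> 0).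
Definition fps_add (R : zmodType) (f g : {fps R}) : {fps R} :=
  FPS (fun n => f n + g n).
Definition fps_opp (R : zmodType) (f : {fps R}) : {fps R} :=
  FPS (fun n => - f n).

Section FpsZmod.
Context (R : zmodType).

Fact fps_addA : associative (@fps_add R).
Proof. by move=> f g h; apply/fpsP => n /=; rewrite addrA. Qed.
Fact fps_addC : commutative (@fps_add R).
Proof. by move=> f g; apply/fpsP => n /=; rewrite addrC. Qed.
Fact fps_add0 : left_id (fps_zero R) (@fps_add R).
Proof. by move=> f; apply/fpsP => n /=; rewrite add0r. Qed.
Fact fps_addN : left_inverse (fps_zero R) (@fps_opp R) (@fps_add R).
Proof. by move=> f; apply/fpsP => n /=; rewrite addNr. Qed.

HB.instance Definition _ :=
  GRing.isZmodule.Build {fps R} fps_addA fps_addC fps_add0 fps_addN.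

Lemma fps_coef0 n : (0 : {fps R}) n = 0. Proof. by []. Qed.
Lemma fps_coefD (f g : {fps R}) n : (f + g) n = f n + g n. Proof. by []. Qed.
Lemma fps_coefN (f : {fps R}) n : (- f) n = - f n. Proof. by []. Qed.
Lemma fps_coefB (f g : {fps R}) n : (f - g) n = f n - g n. Proof. by []. Qed.

End FpsZmod.

Definition fpsC (R : nzRingType) (c : R) : {fps R} :=
  FPS (fun n => if n == 0%N then c else 0).
Definition fpsX (R : nzRingType) : {fps R} := FPS (fun n => (n == 1%N)%:R).
Definition fps_mul (R : nzRingType) (f g : {fps R}) : {fps R} :=
  FPS (fun n => \sum_(i < n.+1) f i * g (n - i)%N).

Section FpsComRing.
Context (R : comNzRingType).
Implicit Types f g h : {fps R}.

Let trunc n f : {poly R} := \poly_(i < n.+1) f i.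

Let truncE n f i : (i <= n)%N -> (trunc n f)`_i = f i.
Proof. by move=> le_in; rewrite coef_poly ltnS le_in. Qed.

Let mul_trunc n f g i : (i <= n)%N ->
  (trunc n f * trunc n g)`_i = fps_mul f g i.
Proof.
move=> le_in; rewrite coefM /=; apply: eq_bigr => j _.
by rewrite !truncE// ?(leq_trans _ le_in) ?leq_subr// -ltnS.
Qed.

Let coefM_low (p p' q q' : {poly R}) n :
  (forall i, (i <= n)%N -> p`_i = p'`_i) ->
  (forall i, (i <= n)%N -> q`_i = q'`_i) -> (p * q)`_n = (p' * q')`_n.
Proof.
move=> pp' qq'; rewrite !coefM; apply: eq_bigr => j _.
by rewrite pp' ?qq' ?leq_subr// -ltnS.
Qed.

Fact fps_mulA : associative (@fps_mul R).
Proof.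
move=> f g h; apply/fpsP => n.
rewrite -!(mul_trunc _ _ (leqnn n)).
transitivity ((trunc n f * (trunc n g * trunc n h))`_n).
  by apply: coefM_low => // i le_in; rewrite mul_trunc// truncE.
rewrite mulrA.
by apply: coefM_low => // i le_in; rewrite mul_trunc// truncE.
Qed.

Fact fps_mulC : commutative (@fps_mul R).
Proof.
by move=> f g; apply/fpsP => n; rewrite -!(mul_trunc _ _ (leqnn n)) mulrC.
Qed.

Fact fps_mul1 : left_id (fpsC 1) (@fps_mul R).
Proof.
move=> f; apply/fpsP => n /=; rewrite big_ord_recl /= mul1r subn0 big1 ?addr0//.
by move=> i _; rewrite mul0r.
Qed.

Fact fps_mulDl : left_distributive (@fps_mul R) +%R.
Proof.
move=> f g h; apply/fpsP => n; rewrite fps_coefD /= -big_split /=.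
by apply: eq_bigr => i _; rewrite mulrDl.
Qed.

Fact fps_oner_neq0 : fpsC 1 != 0 :> {fps R}.
Proof. by apply/eqP => /fpsP/(_ 0%N)/eqP; rewrite oner_eq0. Qed.

HB.instance Definition _ := GRing.Zmodule_isComNzRing.Build {fps R}
  fps_mulA fps_mulC fps_mul1 fps_mulDl fps_oner_neq0.

Lemma fps_coef1 n : (1 : {fps R}) n = (n == 0%N)%:R.
Proof. by case: n. Qed.

Lemma fps_coefM f g n : (f * g) n = \sum_(i < n.+1) f i * g (n - i)%N.
Proof. by []. Qed.

Lemma fps_coefM0 f g : (f * g) 0%N = f 0%N * g 0%N.
Proof. by rewrite fps_coefM big_ord1. Qed.

Lemma fps_coefXnM m f n :
  (fpsX R ^+ m * f) n = if (n < m)%N then 0 else f (n - m)%N.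
Proof.
elim: m n => [|m IHm] n; first by rewrite mul1r ltn0 subn0.
rewrite exprS -mulrA fps_coefM; case: n => [|n].
  by rewrite big_ord1 /= mul0r.
rewrite 2!big_ord_recl /= mul0r add0r mul1r [X in _ + X]big1 ?addr0.
  by rewrite -fps_coefM IHm /bump /= add1n subn1 ltnS subSS.
by move=> i _; rewrite mul0r.
Qed.

Lemma fps_coefMC f (c : R) n : (f * fpsC c) n = f n * c.
Proof.
rewrite fps_coefM big_ord_recr /= subnn eqxx big1 ?add0r// => i _.
by rewrite subn_eq0 leqNgt ltn_ord mulr0.
Qed.

End FpsComRing.

(* The sequence whose n-th term is [step] applied to the list of its first n
   terms. *)
Definition prefix_rec (R : Type) (step : seq R -> R) (n : nat) : R :=
  step (iter n (fun s => rcons s (step s)) [::]).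

Lemma prefix_recE (R : Type) (step : seq R -> R) n :
  prefix_rec step n = step (mkseq (prefix_rec step) n).
Proof.
congr step; elim: n => [|n IHn] //=.
by rewrite mkseqS -IHn.
Qed.

Section FpsUnitRing.
Context (R : comUnitRingType).
Implicit Types f g : {fps R}.

Definition fps_unit : {pred {fps R}} :=
  [pred f : {fps R} | f 0%N \is a GRing.unit].

(* Solves (fps_inv f * f) n = (n == 0) for the n-th coefficient. *)
Definition fps_inv f : {fps R} :=
  if f \in fps_unit then
    FPS (prefix_rec (fun s => ((size s == 0%N)%:R
      - \sum_(i < size s) s`_i * f (size s - i)%N) / f 0%N))
  else f.

Fact fps_mulVf : {in fps_unit, left_inverse 1 fps_inv *%R}.
Proof.
move=> f uf; apply/fpsP => n; rewrite /fps_inv uf fps_coefM fps_coef1.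
rewrite big_ord_recr /= subnn prefix_recE size_mkseq divrK//.
rewrite [X in _ - X](_ : _ = \sum_(i < n) prefix_rec
  (fun s => ((size s == 0%N)%:R
      - \sum_(i < size s) s`_i * f (size s - i)%N) / f 0%N) i * f (n - i)%N).
  by rewrite addrC subrK.
by apply: eq_bigr => i _; rewrite nth_mkseq.
Qed.

Fact fps_unitPl f g : g * f = 1 -> f \in fps_unit.
Proof.
by move=> /fpsP/(_ 0%N); rewrite fps_coefM0 fps_coef1 => gf; apply/unitrPr;
   exists (g 0%N); rewrite mulrC.
Qed.

Fact fps_inv_out : {in [predC fps_unit], fps_inv =1 id}.
Proof. by move=> f nuf; rewrite /fps_inv (negPf nuf). Qed.

HB.instance Definition _ := GRing.ComNzRing_hasMulInverse.Build {fps R}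
  fps_mulVf fps_unitPl fps_inv_out.

Lemma fps_unitE f : (f \is a GRing.unit) = (f 0%N \is a GRing.unit).
Proof. by []. Qed.

End FpsUnitRing.

Definition map_fps (R S : Type) (h : R -> S) (f : {fps R}) : {fps S} :=
  FPS (h \o f).

(* The square root of f with constant term 1; the default value 0 is only
   returned when there is none. *)
Definition fps_sqrt (R : comNzRingType) (f : {fps R}) : {fps R} :=
  xget 0 [set s : {fps R} | s ^+ 2 = f /\ s 0%N = 1]%classic.

Section FpsSqrt.
Context (F : fieldType) (two_neq0 : 2 != 0 :> F).
Implicit Types f s t : {fps F}.

Let sqrt_step f (s : seq F) : F :=
  if size s == 0%N then 1 else
  (f (size s) - \sum_(i < (size s).-1) s`_i.+1 * s`_(size s - i.+1)) / 2.

Lemma fps_sqrt_exists f : f 0%N = 1 ->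
  exists s : {fps F}, s ^+ 2 = f /\ s 0%N = 1.
Proof.
move=> f0; pose c := prefix_rec (sqrt_step f).
have c0 : c 0%N = 1 by [].
exists (FPS c); split=> //; apply/fpsP => -[|n]; rewrite expr2 fps_coefM.
  by rewrite big_ord1 /= c0 mulr1 f0.
rewrite big_ord_recl big_ord_recr /= /bump /= add1n subnn subn0 c0 mul1r mulr1.
have -> : c n.+1 = (f n.+1 - \sum_(i < n) c i.+1 * c (n.+1 - i.+1)%N) / 2.
  transitivity (sqrt_step f (mkseq c n.+1)); first exact: prefix_recE.
  rewrite /sqrt_step size_mkseq [n.+1 == 0%N]/=; congr ((_ - _) / _).
  apply: eq_bigr => i _; rewrite !nth_mkseq //.
    by rewrite subSS ltnS leq_subr.
  by rewrite ltnS.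
set S := (X in _ - X).
by rewrite addrCA -mulr2n -[_ *+ 2]mulr_natr divfK// addrC subrK.
Qed.

Lemma fps_sqrt_unique s t :
  s ^+ 2 = t ^+ 2 -> s 0%N = 1 -> t 0%N = 1 -> s = t.
Proof.
move=> st s0 t0; have u : s + t \is a GRing.unit.
  by rewrite fps_unitE fps_coefD s0 t0 unitfE.
apply/eqP; rewrite -subr_eq0; apply/eqP/(mulIr u).
by rewrite mul0r -subr_sqr st subrr.
Qed.

Lemma fps_sqrtP f : f 0%N = 1 -> fps_sqrt f ^+ 2 = f /\ fps_sqrt f 0%N = 1.
Proof. by move=> /fps_sqrt_exists ex; exact: (xgetPex 0 ex). Qed.

End FpsSqrt.

(* The sum is taken coefficientwise. The coefficient [\sum_(i \in _)] is 0 by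
   convention if infinitely many terms contribute to it; [fps_summable] rules
   this out. *)
Definition fps_sum (R : comNzRingType) (I : choiceType) (F : I -> {fps R}) :
    {fps R} :=
  FPS (fun n => \sum_(i \in [set: I]%classic) F i n).

Definition fps_summable (R : comNzRingType) (I : choiceType)
    (F : I -> {fps R}) : Prop :=
  forall n, finite_set [set i | F i n != 0]%classic.

Inductive fbtree := Leaf | Node of fbtree & fbtree.

Fixpoint fbtree_encode (T : fbtree) : GenTree.tree void :=
  match T with
  | Leaf => GenTree.Node 0 [::]
  | Node TL TR => GenTree.Node 1 [:: fbtree_encode TL; fbtree_encode TR]
  end.

Fixpoint fbtree_decode (t : GenTree.tree void) : option fbtree :=
  match t with
  | GenTree.Node 0 [::] => Some Leaf
  | GenTree.Node 1 [:: tl; tr] =>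
      if fbtree_decode tl is Some TL then
        if fbtree_decode tr is Some TR then Some (Node TL TR) else None
      else None
  | _ => None
  end.

Lemma fbtree_encodeK : pcancel fbtree_encode fbtree_decode.
Proof. by elim=> //= TL -> TR ->. Qed.

HB.instance Definition _ := Countable.copy fbtree (pcan_type fbtree_encodeK).

Fixpoint internal_vertices (T : fbtree) : nat :=
  match T with
  | Leaf => 0
  | Node TL TR => internal_vertices TL + internal_vertices TR + 1
  end.

Fixpoint rightmost_depth (T : fbtree) : nat :=
  match T with
  | Leaf => 0
  | Node TL TR => 1 + rightmost_depth TR
  end.

Fixpoint jump_distances (T : fbtree) : nat :=
  match T with
  | Leaf => 0
  | Node TL TR => jump_distances TL + jump_distances TR + rightmost_depth TL
  end.

(* An element of Q[q][[x]]: here 'X is the variable q, and fpsX is x. *)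
Definition K_term (T : fbtree) : {fps {poly rat}} :=
  fpsX _ ^+ internal_vertices T * fpsC ('X ^+ jump_distances T).

Definition K : {fps {poly rat}} := fps_sum K_term.

Lemma fbtree_finite n :
  finite_set [set T | (internal_vertices T <= n)%N]%classic.
Proof.
elim: n => [|n IHn].
  apply: (@sub_finite_set _ _ [set Leaf]%classic); last exact: finite_set1.
  by move=> [//|TL TR] /=; rewrite addn1.
pose A := [set T | (internal_vertices T <= n)%N]%classic.
apply: (@sub_finite_set _ _
  ([set Leaf] `|` (fun p => Node p.1 p.2) @` (A `*` A))%classic).
  move=> [|TL TR] /=; first by left.
  rewrite addn1 ltnS => le_n; right; exists (TL, TR) => //; split => /=.
    exact: leq_trans (leq_addr _ _) le_n.
  exact: leq_trans (leq_addl _ _) le_n.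
rewrite finite_setU; split; first exact: finite_set1.
by apply: finite_image; apply: finite_setX.
Qed.

Lemma K_summable : fps_summable K_term.
Proof.
move=> n; apply: sub_finite_set (fbtree_finite n) => T.
by rewrite /mkset /K_term fps_coefXnM; case: ltnP => //; rewrite eqxx.
Qed.

(* The variable q as a constant of Q(q)[[x]]. *)
Definition fps_q : {fps {fraction {poly rat}}} := fpsC (tofrac 'X).

Lemma two_neq0_Qq : 2 != 0 :> {fraction {poly rat}}.
Proof.
rewrite -(rmorph_nat (@tofrac {poly rat})) tofrac_eq0.
by rewrite -polyC_natr polyC_eq0.
Qed.

(* So the quotient by this series is a genuine division. *)
Lemma fps_denominator_unit :
  fps_sqrt (1 - 4 * fps_q * fpsX _) - 1 + 2 * fps_q \is a GRing.unit.
Proof.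
have f0 : (1 - 4 * fps_q * fpsX _ : {fps {fraction {poly rat}}}) 0%N = 1.
  by rewrite fps_coefB fps_coef1 fps_coefM0 mulr0 subr0.
have [_ s0] := fps_sqrtP two_neq0_Qq f0.
rewrite fps_unitE fps_coefD fps_coefB s0 fps_coef1 subrr add0r fps_coefM0.
by rewrite (_ : (2 : {fps _}) 0%N = 2)// unitfE mulf_neq0 ?two_neq0_Qq//
  tofrac_eq0 polyX_eq0.
Qed.

(* Main.v *)
(** Weight every tree by x^V(T) q^JD(T) z^D(T).  Splitting a tree at its root
    multiplies the weight of the left subtree, taken at z = q, by x z times the
    weight of the right subtree.  Taking z = q and z = 1 gives, for the series C
    of the weights x^V q^(JD + D),
    C = 1 + q x C^2  and  K = 1 + x C K.
    The first equation says that 1 - 2 q x C is the square root of 1 - 4 q x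
    with constant term 1, and then 2 q = 2 q (1 - x C) K is the claim. *)

Require Import Defs.
From mathcomp Require Import all_boot all_order all_algebra.
From mathcomp Require Import boolp classical_sets functions cardinality fsbigop.
From mathcomp Require Import ring.
Import GRing.Theory.
Local Open Scope ring_scope.

Set Implicit Arguments.
Unset Strict Implicit.
Unset Printing Implicit Defensive.

Definition trees_of_size (n : nat) : set fbtree :=
  [set T | internal_vertices T = n]%classic.

Lemma finite_trees_of_size n : finite_set (trees_of_size n).
Proof.
by apply: sub_finite_set (fbtree_finite n) => T; rewrite /trees_of_size /= => ->.
Qed.

Lemma trees_of_size0 : trees_of_size 0 = [set Leaf]%classic.
Proof.
apply/seteqP; split=> [|T ->//] [//|TL TR].
by rewrite /trees_of_size /= addn1.
Qed.

Section TreeSeries.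
Context (R : idomainType).
Implicit Types (f g : fbtree -> R) (n : nat).

(** Grouping trees by size makes each coefficient a sum over a finite set, which can be split and
    reindexed. *)
Definition tree_series g : {fps R} :=
  FPS (fun n => \sum_(T \in trees_of_size n) g T).

(** Cutting at the root is a bijection onto the pairs of trees with [n] internal vertices in total;
    these are then sorted by the size of the left tree. *)
Lemma sum_trees_of_sizeS g n :
  \sum_(T \in trees_of_size n.+1) g T =
  \sum_(i < n.+1) \sum_(TL \in trees_of_size i)
    \sum_(TR \in trees_of_size (n - i)%N) g (Node TL TR).
Proof.
pose node (p : fbtree * fbtree) := Node p.1 p.2.
pose V (p : fbtree * fbtree) := internal_vertices p.1.
pose P := [set p | (V p + internal_vertices p.2 = n)%N]%classic.
have Pfin : finite_set P.
  apply: sub_finite_set (finite_setX (fbtree_finite n) (fbtree_finite n)).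
  by move=> p /= <-; split; rewrite /= ?leq_addr ?leq_addl.
have nodeP : set_bij P (trees_of_size n.+1) node.
  split; first by move=> p /= pn; rewrite /trees_of_size /= addn1 pn.
    by move=> [a b] [c d] _ _ [-> ->].
  move=> [//|TL TR]; rewrite /trees_of_size /= addn1 => -[Tn].
  by exists (TL, TR).
rewrite (reindex_fsbig node P _ _ nodeP).
(* Each pair is counted once, at the index [i = V p], which is at most [n]; the two sums can then be
   exchanged. *)
transitivity (\sum_(p \in P) \sum_(i \in `I_n.+1)
    if i \in [set V p]%classic then g (node p) else 0).
  apply: eq_fsbigr => p; rewrite inE => Pp.
  rewrite -fsbig_mkcondr (_ : _ `&` _ = [set V p])%classic ?fsbig_set1//.
  apply/setIidPr => _ ->; rewrite /= ltnS -[X in (_ <= X)%N]Pp; exact: leq_addr.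
rewrite exchange_fsbig//.
rewrite [RHS](fsbig_ord _ _ (fun i => \sum_(TL \in trees_of_size i)
    \sum_(TR \in trees_of_size (n - i)%N) g (Node TL TR))).
apply: eq_fsbigr => i; rewrite inE /= ltnS => le_in.
rewrite pair_fsbig; try exact: finite_trees_of_size.
transitivity (\sum_(p \in P) if p \in (V @^-1` [set i])%classic
    then g (node p) else 0).
  apply: eq_fsbigr => p _; congr (if _ then _ else _).
  by apply/idP/idP; rewrite !inE /= => ->.
(* Once the left size is [i], membership in [P] fixes the right size as [n - i]; no truncation
   occurs because [i <= n]. *)
rewrite -fsbig_mkcondr; apply: eq_fsbigl; apply/seteqP; split=> p /=.
  by case=> <- Vi; split=> //=; rewrite /trees_of_size /= -Vi addKn.
by case; rewrite /trees_of_size /P /V /= => -> ->; rewrite subnKC.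
Qed.

(** The root contributes [c] and one factor x, and the sum over pairs of subtrees is a Cauchy
    product. The left weight [f] may differ from [g], since a left subtree also pays for its
    depth. *)
Lemma tree_series_node (c : R) f g :
    (forall TL TR, g (Node TL TR) = c * (f TL * g TR)) ->
  tree_series g =
    fpsC (g Leaf) + fpsC c * fpsX R * tree_series f * tree_series g.
Proof.
move=> gE.
have -> : fpsC c * fpsX R * tree_series f * tree_series g =
    fpsX R ^+ 1 * (tree_series f * tree_series g * fpsC c) by ring.
apply/fpsP => -[|n]; rewrite fps_coefD fps_coefXnM.
  by rewrite addr0 /= trees_of_size0 fsbig_set1.
rewrite subSS subn0 fps_coefMC [LHS]sum_trees_of_sizeS add0r fps_coefM mulr_suml.
apply: eq_bigr => i _; rewrite mulrC /= mulr_fsuml mulr_fsumr.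
apply: eq_fsbigr => TL _; rewrite mulrA !mulr_fsumr.
by apply: eq_fsbigr => TR _; rewrite gE mulrA.
Qed.

End TreeSeries.

Section MapFps.
Context (R S : comNzRingType) (h : {rmorphism R -> S}).

Lemma map_fpsD : {morph map_fps h : f g / f + g}.
Proof. by move=> f g; apply/fpsP => n; exact: rmorphD. Qed.

Lemma map_fpsM : {morph map_fps h : f g / f * g}.
Proof.
move=> f g; apply/fpsP => n; rewrite /= rmorph_sum.
by apply: eq_bigr => i _; rewrite rmorphM.
Qed.

Lemma map_fpsC c : map_fps h (fpsC c) = fpsC (h c).
Proof. by apply/fpsP => -[|n] //=; rewrite rmorph0. Qed.

Lemma map_fpsX : map_fps h (fpsX R) = fpsX S.
Proof. by apply/fpsP => n /=; rewrite rmorph_nat. Qed.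

End MapFps.

Lemma K_tree_series : K = tree_series (fun T => 'X ^+ jump_distances T).
Proof.
apply/fpsP => n; rewrite [RHS]fsbig_mkcond; apply: eq_fsbigr => T _.
rewrite /patch /K_term fps_coefXnM /=.
have [|] := boolP (T \in trees_of_size n).
  by rewrite inE => <-; rewrite ltnn subnn.
(* A larger tree is killed by the shift by x^V, a smaller one because a constant series vanishes at
   positive indices. *)
rewrite notin_setE /trees_of_size /= => /eqP; rewrite neq_ltn subn_eq0.
by case: ltngtP.
Qed.

(** The square of 1 - 2aC is 1 - 4a(C - aC^2) = 1 - 4a, and its constant term 1 singles out the
    root. *)
Lemma sqrt_catalan (F : fieldType) (a C : {fps F}) : 2 != 0 :> F ->
  a 0%N = 0 -> C = 1 + a * C ^+ 2 -> fps_sqrt (1 - 4 * a) = 1 - 2 * a * C.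
Proof.
move=> two_neq0 a0 CE.
have f0 : (1 - 4 * a) 0%N = 1.
  by rewrite fps_coefB fps_coef1 fps_coefM0 a0 mulr0 subr0.
have [sE s0] := fps_sqrtP two_neq0 f0.
apply: (fps_sqrt_unique two_neq0) => //; last first.
  by rewrite fps_coefB fps_coef1 !fps_coefM0 a0 mulr0 mul0r subr0.
rewrite sE; transitivity (1 - 4 * a * (C - a * C ^+ 2)); last by ring.
by rewrite {1}CE addrK mulr1.
Qed.

Theorem theorem6 :
  let x : {fps {fraction {poly rat}}} := fpsX _ in
  let q : {fps {fraction {poly rat}}} := fps_q in
  map_fps (@tofrac {poly rat}) K =
    2 * q / (fps_sqrt (1 - 4 * q * x) - 1 + 2 * q).
Proof.
move=> x q.
pose JD T : {poly rat} := 'X ^+ jump_distances T.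
pose JDD T : {poly rat} := 'X ^+ (jump_distances T + rightmost_depth T).
have JDE TL TR : JD (Node TL TR) = 1 * (JDD TL * JD TR).
  by rewrite mul1r -exprD addnAC.
(* The extra factor ['X] is the edge from the root to the right subtree. *)
have JDDE TL TR : JDD (Node TL TR) = 'X * (JDD TL * JDD TR).
  by rewrite -exprD -exprS; congr (_ ^+ _); rewrite /=; ring.
pose map := map_fps (@tofrac {poly rat}).
pose C := map (tree_series JDD).
have CE : C = 1 + q * x * C ^+ 2.
  rewrite {1}/C /map (tree_series_node JDDE) map_fpsD !map_fpsM !map_fpsC map_fpsX.
  by rewrite (_ : JDD Leaf = 1)// rmorph1 expr2 mulrA.
have KE : map K = 1 + x * C * map K.
  rewrite /map {1}K_tree_series (tree_series_node JDE) map_fpsD !map_fpsM !map_fpsC.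
  by rewrite map_fpsX (_ : JD Leaf = 1)// rmorph1 mul1r -K_tree_series.
have qx0 : (q * x) 0%N = 0 by rewrite fps_coefM0 mulr0.
(* After clearing the denominator, the square root turns it into 2q(1 - xC). *)
apply: (canRL (mulrK fps_denominator_unit)).
rewrite -/x -/q -mulrA (sqrt_catalan two_neq0_Qq qx0 CE) -/map.
transitivity (2 * q * (map K - x * C * map K)); first by ring.
by rewrite {1}KE addrK mulr1.
Qed.
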